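(* Let $G$ be a finite Abelian group with $|G| \ge 2$, let $m$ and $K$ be positive integers, and suppose that $A_1,\ldots,A_{2K} \subseteq G$ satisfy $mA_i = G$ for all $1 \le i \le 2K$. If $K \ge m \ln \log_2(|G|)$, then $A_1+\cdots+A_{2K}=G$. Moreover, for $m=2$, the same conclusion $A_1+\cdots+A_{2K}=G$ holds under the condition $K \ge \log_2 \log_2(|G|)$ in place of $K \ge m \ln \log_2(|G|)$.
   Context: For subsets $A,B$ of an Abelian group $G$ (written additively), the sumset is $A+B=\{a+b : a\in A,\ b\in B\}$, and $A_1+\cdots+A_k$ denotes the iterated sumset. For $A\subseteq G$ and a positive integer $m$, $mA = A+\cdots+A$ ($m$ summands) denotes the $m$-fold sumset of $A$ (not the dilate of $A$). Here $\ln$ is the natural logarithm and $\log_2$ is the logarithm in base $2$. *)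

(* Defs.v *)
From mathcomp Require Import all_boot all_order all_algebra.
From mathcomp Require Import reals exp.

Set Implicit Arguments.
Unset Strict Implicit.
Unset Printing Implicit Defensive.

Import GRing.Theory.
Local Open Scope ring_scope.

Definition sumset (G : finZmodType) (A B : {set G}) : {set G} :=
  [set a + b | a in A, b in B].

(* The empty iterated sumset is the neutral element {0} of sumset. *)
Definition iter_sumset (G : finZmodType) (k : nat) (A : 'I_k -> {set G}) :
    {set G} :=
  \big[@sumset G/[set 0]]_(i < k) A i.

(* mA = A + ... + A with m summands, not the dilate {m a : a in A}. *)
Definition mfold_sumset (G : finZmodType) (m : nat) (A : {set G}) : {set G} :=
  iter_sumset (fun _ : 'I_m => A).

Definition log2 (R : realType) (x : R) : R := ln x / ln 2.

(* Main.v *)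
(** By Petridis' argument, a nonempty subset [X] of [B] minimising
    [|X + A| / |X|] satisfies [|X + A + C| |X| <= |X + A| |X + C|] for all [C].
    Iterating with [mA = G] yields [|G| |B|^(m-1) <= |A + B|^m], so that the
    defect [ln (|G| / |B|)] shrinks by a factor [1 - 1/m] each time a summand is
    added. After [K] summands it is smaller than [ln 2]; hence each half of
    [A_1 + ... + A_2K] has more than [|G| / 2] elements, and two such sets
    have sum [G] by pigeonhole. For [m = 2] the strict inequality
    comes from the first step: [2A = G] forces [|A|^2 > |G|], since [a + b = b + a]. *)

Require Import Defs.
From HB Require Import structures.
From mathcomp Require Import all_boot all_order all_algebra.
From mathcomp Require Import reals sequences exp.
From mathcomp Require Import zify ring lra.

Set Implicit Arguments.
Unset Strict Implicit.
Unset Printing Implicit Defensive.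

Import Order.TTheory GRing.Theory Num.Theory.
Local Open Scope ring_scope.

(** * The commutative monoid of subsets under [sumset] *)

Section Sumset.
Variable G : finZmodType.
Implicit Types (A B C X Z : {set G}) (s : seq {set G}).

Lemma sumsetC : commutative (@sumset G).
Proof.
move=> A B; apply/setP=> x; apply/imset2P/imset2P=> -[a b aA bB ->];
  by exists b a => //; rewrite addrC.
Qed.

Lemma sumsetA : associative (@sumset G).
Proof.
move=> A B C; apply/setP=> x; apply/imset2P/imset2P.
  case=> a y aA /imset2P[b c bB cC ->] ->.
  by exists (a + b) c; rewrite ?addrA //; apply: imset2_f.
case=> y c /imset2P[a b aA bB ->] cC ->.
by exists a (b + c); rewrite ?addrA //; apply: imset2_f.
Qed.

Lemma sumset0 A : sumset set0 A = set0.
Proof. by apply/setP=> x; rewrite inE; apply/imset2P=> -[a b]; rewrite inE. Qed.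

Lemma sumset_translateE A c : sumset A [set c] = [set a + c | a in A].
Proof.
apply/setP=> x; apply/imset2P/imsetP=> [[a b aA /set1P-> ->]|[a aA ->]].
  by exists a.
by exists a c => //; rewrite set11.
Qed.

Lemma sum0set : left_id [set 0] (@sumset G).
Proof.
move=> A; rewrite sumsetC sumset_translateE.
by under eq_imset do rewrite addr0; rewrite imset_id.
Qed.

(** Makes [big_cat] available, which later cuts the iterated sumset into two halves. *)
HB.instance Definition _ :=
  Monoid.isComLaw.Build {set G} [set 0] (@sumset G) sumsetA sumsetC sum0set.

Lemma sumsetS A B C : A \subset B -> sumset A C \subset sumset B C.
Proof. by move=> AB; apply: imset2S. Qed.

Lemma sumsetSr A B C : A \subset B -> sumset C A \subset sumset C B.
Proof. by move=> AB; apply: imset2S. Qed.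

Lemma sumsetUr A B C : sumset A (B :|: C) = sumset A B :|: sumset A C.
Proof.
apply/eqP; rewrite eqEsubset subUset !sumsetSr ?subsetUl ?subsetUr // !andbT.
apply/subsetP=> x /imset2P[a b aA /setUP[bB|bC] ->]; apply/setUP.
  by left; apply: imset2_f.
by right; apply: imset2_f.
Qed.

(** * Cardinality inequalities for sumsets *)

Lemma card_sumset_translate A c : #|sumset A [set c]| = #|A|.
Proof. by rewrite sumset_translateE card_imset //; apply: addIr. Qed.

Lemma card_sumset_gt0 A B :
  (0 < #|A|)%N -> (0 < #|B|)%N -> (0 < #|sumset A B|)%N.
Proof.
move=> /card_gt0P[a aA] /card_gt0P[b bB].
by apply/card_gt0P; exists (a + b); apply: imset2_f.
Qed.

(** Induction on [#|C|], adding one element [c] to [D]. The set [X + A] gains at most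
    [|X + A| - |Z + A|] points and [X] gains at least [|X| - |Z|], for the set [Z] below; minimality
    applied to [Z] compares the two gains. *)
Lemma petridis A X C :
    (forall Z, Z \subset X -> #|sumset X A| * #|Z| <= #|sumset Z A| * #|X|)%N ->
  (#|sumset (sumset X A) C| * #|X| <= #|sumset X A| * #|sumset X C|)%N.
Proof.
move=> minX; have [n] := ubnP #|C|; elim: n C => // n IHn C.
have [->|[c cC]] := set_0Vmem C => ltCn.
  by rewrite !(sumsetC _ set0) !sumset0 !cards0.
rewrite -(setD1K cC) setUC; set D := C :\ c.
have {IHn} IHD : (#|sumset (sumset X A) D| * #|X|
                   <= #|sumset X A| * #|sumset X D|)%N.
  by apply: IHn; rewrite (cardsD1 c C) cC in ltCn; rewrite /D; lia.
(* The elements [x] whose translate [x + A + c] brings nothing new to [X + A + D]. *)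
pose Z := [set x in X | sumset (sumset [set x] A) [set c]
                          \subset sumset (sumset X A) D].
have ZX : Z \subset X by apply/subsetP=> x; rewrite inE => /andP[].
have ZAc : sumset (sumset Z A) [set c]
             \subset sumset (sumset X A) D :&: sumset (sumset X A) [set c].
  rewrite subsetI !sumsetS // andbT; apply/subsetP=> y.
  case/imset2P=> w c' /imset2P[z a + aA ->] cc ->.
  rewrite inE => /andP[_ /subsetP]; apply.
  by apply: imset2_f => //; apply: imset2_f; rewrite ?set11.
(* If [x + c] lies in [X + D], then adding [A] puts [x + A + c] inside [X + A + D], so [x] is in
   [Z]. *)
have XDc : sumset X D :&: sumset X [set c] \subset sumset Z [set c].
  apply/subsetP=> y /setIP[yXD /imset2P[x c' xX /set1P-> def_y]].
  rewrite def_y in yXD *; apply: imset2_f; last exact: set11.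
  rewrite inE xX /=.
  have -> : sumset (sumset [set x] A) [set c] = sumset [set x + c] A.
    rewrite -sumsetA [sumset A _]sumsetC sumsetA.
    by rewrite [sumset _ [set c]]sumset_translateE imset_set1.
  rewrite -sumsetA [sumset A D]sumsetC sumsetA.
  by apply: sumsetS; rewrite sub1set.
have := subset_leq_card ZAc; have := subset_leq_card XDc.
rewrite !card_sumset_translate !sumsetUr => leZ geZ.
have := cardsUI (sumset (sumset X A) D) (sumset (sumset X A) [set c]).
have := cardsUI (sumset X D) (sumset X [set c]).
rewrite !card_sumset_translate => eqX eqXA.
have := minX _ ZX; nia.
Qed.

Lemma mfold_sumsetS m A : mfold_sumset m.+1 A = sumset A (mfold_sumset m A).
Proof. by rewrite /mfold_sumset /iter_sumset big_ord_recl. Qed.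

(** [X] minimises [|X + A| / |X|] over nonempty subsets of [B]; comparing it with [B] gives the
    first inequality, and [petridis] with [C = mA] is the induction step of the second. *)
Lemma plunnecke m A B : (0 < #|B|)%N ->
  exists X, [/\ X \subset B, (0 < #|X|)%N,
    (#|sumset X A| * #|B| <= #|sumset B A| * #|X|)%N &
    (#|sumset X (mfold_sumset m A)| * #|X| ^ m <= #|sumset X A| ^ m * #|X|)%N].
Proof.
move=> B0; pose P X := (X \subset B) && (0 < #|X|)%N.
pose F X : rat := #|sumset X A|%:R / #|X|%:R.
have PB : P B by rewrite /P subxx.
have [X /andP[XB X0] minX] := @Order.TotalTheory.arg_minP _ _ _ B P F PB.
(* In cross-multiplied form minimality also covers the empty [Z]. *)
have {}minX Z : Z \subset B -> (#|sumset X A| * #|Z| <= #|sumset Z A| * #|X|)%N.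
  move=> ZB; have [->|Z0] := posnP #|Z|; first by rewrite muln0.
  have := minX Z; rewrite /P ZB Z0 => /(_ isT).
  by rewrite /F ler_pdivrMr ?ltr0n // mulrAC ler_pdivlMr ?ltr0n //
             -!natrM ler_nat.
exists X; split=> //; first exact: minX.
elim: m => [|m IHm].
  rewrite /mfold_sumset /iter_sumset big_ord0 sumsetC sum0set.
  by rewrite expn0 muln1 mul1n.
rewrite mfold_sumsetS sumsetA.
have := @petridis A X (mfold_sumset m A) (fun Z ZX => minX Z (subset_trans ZX XB)).
rewrite !expnS => le1; rewrite mulnA.
apply: leq_trans (leq_mul le1 (leqnn _)) _.
by rewrite -!mulnA leq_mul.
Qed.

Lemma card_sumset_basis m A B : (0 < #|B|)%N ->
  mfold_sumset m.+1 A = [set: G] ->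
  (#|G| * #|B| ^ m <= #|sumset A B| ^ m.+1)%N.
Proof.
move=> B0 mA; have [X [XB X0 leXB leXA]] := plunnecke m.+1 A B0.
have XG : sumset X [set: G] = [set: G].
  have /card_gt0P[x xX] := X0; apply/eqP; rewrite -subTset; apply/subsetP=> y _.
  by rewrite -[y](subrKC x); apply: imset2_f; rewrite ?inE.
rewrite mA XG cardsT [sumset X A]sumsetC in leXA.
rewrite [sumset X A]sumsetC [sumset B A]sumsetC in leXB.
(* This factor cancels at the end of the chain: [leXA], then the [m.+1]-st power of [leXB], then
   [|X| <= |B|]. *)
rewrite -(leq_pmul2r (_ : 0 < #|X| ^ m.+1 * #|B|)%N); last first.
  by rewrite muln_gt0 expn_gt0 X0.
have leXBm : ((#|sumset A X| * #|B|) ^ m.+1 <= (#|sumset A B| * #|X|) ^ m.+1)%N.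
  by rewrite leq_exp2r.
have := leq_mul leXBm (subset_leq_card XB).
have := leq_mul leXA (leqnn (#|B| ^ m.+1)%N).
rewrite !expnMn [(#|B| ^ m.+1)%N]expnS.
move: (#|sumset A X| ^ _)%N (#|sumset A B| ^ _)%N (#|X| ^ _)%N (#|B| ^ _)%N.
by move: #|G| #|B| #|X| => g b x p q r t; clear; lia.
Qed.

Lemma basis_neq0 m A : (0 < m)%N -> mfold_sumset m A = [set: G] -> (0 < #|A|)%N.
Proof.
case: m => // m _ mA; rewrite card_gt0; apply/eqP=> A0.
move/setP/(_ 0): mA.
by rewrite mfold_sumsetS A0 sumset0 !inE.
Qed.

(** Addition maps [A x A] onto [G]. Equal sizes would make it injective, and the pairs [(a, b)],
    [(b, a)] would then force [|A| <= 1]. *)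
Lemma card_basis2 A : (1 < #|G|)%N -> mfold_sumset 2 A = [set: G] ->
  (#|G| < #|A| ^ 2)%N.
Proof.
rewrite 2!mfold_sumsetS /mfold_sumset /iter_sumset big_ord0.
rewrite [sumset A [set 0]]sumsetC sum0set => G1 AA.
have imA : [set x.1 + x.2 | x in setX A A] = [set: G].
  apply/setP=> y; rewrite -AA; apply/imsetP/imset2P=> [[[a b]]|[a b aA bA ->]].
    by rewrite inE /= => /andP[aA bA] ->; exists a b.
  by exists (a, b); rewrite ?inE ?aA.
have leG : (#|G| <= #|setX A A|)%N by rewrite -cardsT -imA leq_imset_card.
rewrite -mulnn -cardsX ltn_neqAle leG andbT; apply/eqP=> eqG.
have /imset_injP injA : #|[set x.1 + x.2 | x in setX A A]| == #|setX A A|.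
  by rewrite imA cardsT eqG.
suff : (#|A| <= 1)%N by move: G1; rewrite eqG cardsX; nia.
apply/card_le1P=> a aA b; rewrite inE.
apply/idP/eqP=> [bA|->//].
have := injA (a, b) (b, a); rewrite !inE /= aA bA addrC => /(_ isT isT erefl).
by case.
Qed.

(** For each [y], the sets [A] and [y - B] are together larger than [G], so they meet. *)
Lemma sumset_large A B :
  (#|G| < 2 * #|A|)%N -> (#|G| < 2 * #|B|)%N -> sumset A B = [set: G].
Proof.
move=> ltA ltB; apply/eqP; rewrite -subTset; apply/subsetP=> y _.
pose B' := [set y - b | b in B].
have cB' : #|B'| = #|B|.
  by rewrite card_imset // => b c /addrI/oppr_inj.
have /card_gt0P[a /setIP[aA /imsetP[b bB def_a]]] : (0 < #|A :&: B'|)%N.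
  have := max_card (mem (A :|: B')); have := cardsUI A B'; rewrite cB'.
  move: #|A :|: B'| #|A :&: B'| #|A| #|B| #|G| ltA ltB => u i a b g; lia.
by rewrite -[y](subrK b) -def_a; apply: imset2_f.
Qed.

(** * Contraction of the logarithmic defect *)

Section Defect.
Variable R : realType.

(** Logarithm of the inverse density, in which the power inequality becomes linear. Since
    [ln 0 = 0], it carries this meaning only for nonempty sets. *)
Definition defect A : R := ln #|G|%:R - ln #|A|%:R.

Lemma defect_sumset m A B : (0 < m)%N -> (0 < #|B|)%N ->
  mfold_sumset m A = [set: G] ->
  defect (sumset A B) <= (1 - m%:R^-1) * defect B.
Proof.
case: m => // m _ B0 mA; have A0 := basis_neq0 (ltn0Sn m) mA.
have AB0 := card_sumset_gt0 A0 B0.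
have G0 : (0 < #|G|)%N := leq_trans B0 (max_card _).
have m0 : 0 < m.+1%:R :> R by rewrite ltr0n.
have : ln ((#|G| * #|B| ^ m)%N%:R : R) <= ln ((#|sumset A B| ^ m.+1)%N%:R).
  rewrite ler_ln ?posrE ?ltr0n ?muln_gt0 ?expn_gt0 ?G0 ?B0 ?AB0 //.
  by rewrite ler_nat card_sumset_basis.
rewrite natrM !natrX lnM ?posrE ?exprn_gt0 ?ltr0n //.
rewrite (lnXn m) ?(lnXn m.+1) ?ltr0n // => le_ln.
have mB : m.+1%:R * (1 - m.+1%:R^-1) = m.+1%:R - 1 :> R.
  by rewrite mulrBr mulr1 divff // gt_eqF.
rewrite -(ler_pM2l m0) mulrA mB /defect.
move: le_ln; rewrite -[ln _ *+ m]mulr_natl -[ln _ *+ m.+1]mulr_natl.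
rewrite -[m.+1]addn1 natrD; lra.
Qed.

Lemma big_sumset_gt0 m s : (0 < m)%N ->
  {in s, forall A, mfold_sumset m A = [set: G]} ->
  (0 < #|\big[@sumset G/[set 0%R]]_(A <- s) A|)%N.
Proof.
move=> m0; elim: s => [|A s IHs] hs; first by rewrite big_nil cards1.
rewrite big_cons card_sumset_gt0 //.
  by apply: (basis_neq0 m0); apply: hs; rewrite mem_head.
by apply: IHs => B Bs; apply: hs; rewrite in_cons Bs orbT.
Qed.

(** The seed [B] is left free: it will be [{0}] for general [m], and the first summand for
    [m = 2]. *)
Lemma defect_big_sumset m s B : (0 < m)%N -> (0 < #|B|)%N ->
  {in s, forall A, mfold_sumset m A = [set: G]} ->
  defect (sumset (\big[@sumset G/[set 0]]_(A <- s) A) B)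
    <= (1 - m%:R^-1) ^+ size s * defect B.
Proof.
move=> m0 B0; elim: s => [|A s IHs] hs.
  by rewrite big_nil sum0set expr0 mul1r.
have hs' : {in s, forall A, mfold_sumset m A = [set: G]}.
  by move=> C Cs; apply: hs; rewrite in_cons Cs orbT.
rewrite big_cons -sumsetA.
apply: le_trans (defect_sumset m0 _ (hs _ (mem_head _ _))) _.
  by rewrite card_sumset_gt0 // (big_sumset_gt0 m0).
rewrite exprS -mulrA ler_wpM2l ?IHs // subr_ge0 invf_le1 ?ltr0n //.
by rewrite ler1n.
Qed.

Lemma defect_half A : (0 < #|A|)%N -> defect A < ln 2 -> (#|G| < 2 * #|A|)%N.
Proof.
move=> A0; rewrite ltrBlDr -lnM ?posrE ?ltr0n // ltr_ln ?posrE ?mulr_gt0 ?ltr0n //.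
  by rewrite -natrM ltr_nat.
exact: leq_trans A0 (max_card _).
Qed.

Lemma defect0 : defect [set 0] = ln #|G|%:R.
Proof. by rewrite /defect cards1 ln1 subr0. Qed.

Lemma log2_gt0 : (1 < #|G|)%N -> 0 < log2 (#|G|%:R : R).
Proof. by move=> G1; rewrite divr_gt0 ?ln_gt0 ?ltr1n. Qed.

Lemma ln2_gt0 : 0 < ln 2 :> R.
Proof. by rewrite ln_gt0 ?ltr1n. Qed.

Lemma half_of_ln m s : (1 < #|G|)%N -> (0 < m)%N -> (0 < size s)%N ->
    {in s, forall A, mfold_sumset m A = [set: G]} ->
    m%:R * ln (log2 (#|G|%:R : R)) <= (size s)%:R ->
  (#|G| < 2 * #|\big[@sumset G/[set 0%R]]_(A <- s) A|)%N.
Proof.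
move=> G1 m0 s0 hs le_s; apply: defect_half; first exact: (big_sumset_gt0 m0).
have := @defect_big_sumset m s [set 0] m0; rewrite cards1 => /(_ isT hs).
rewrite sumsetC sum0set defect0 => /le_lt_trans; apply.
have m0R : 0 < m%:R :> R by rewrite ltr0n.
have L0 := log2_gt0 G1.
rewrite -[ln _ in X in X < _](divfK (lt0r_neq0 ln2_gt0)) mulrA gtr_pMl ?ln2_gt0 //.
rewrite -[_ / _]/(log2 _) -ltr_pdivlMr // div1r.
(* Strictness comes from [1 + x < expR x] at [x = - 1/m], and survives the power because [s] is
   nonempty. *)
apply: (@lt_le_trans _ _ (expR (- m%:R^-1) ^+ size s)).
  rewrite ltrXn2r -?lt0n //.
    by rewrite subr_ge0 invf_le1 ?ler1n.
  by rewrite expR_gt1Dx // oppr_eq0 invr_eq0 gt_eqF.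
rewrite -expRM_natl -[X in _ <= X^-1](lnK L0) -expRN ler_expR.
by rewrite mulrN lerN2 ler_pdivlMr // mulrC.
Qed.

(** Halving the defect of [{0}] at each step would only give [<= ln 2]. Seeding with the first
    summand, whose defect is strictly below half of [ln |G|], makes the bound strict. *)
Lemma half_of_log2 s : (1 < #|G|)%N -> (0 < size s)%N ->
    {in s, forall A, mfold_sumset 2 A = [set: G]} ->
    log2 (log2 (#|G|%:R : R)) <= (size s)%:R ->
  (#|G| < 2 * #|\big[@sumset G/[set 0%R]]_(A <- s) A|)%N.
Proof.
case: s => // A s G1 _ hs le_s; apply: defect_half; first exact: (@big_sumset_gt0 2).
have A2 := hs _ (mem_head _ _).
have A0 : (0 < #|A|)%N by apply: (@basis_neq0 2).
rewrite big_cons sumsetC; apply: le_lt_trans (@defect_big_sumset 2 _ _ _ _ _) _ => //.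
  by move=> C Cs; apply: hs; rewrite in_cons Cs orbT.
have dA : defect A < 2^-1 * ln #|G|%:R.
  have : ln (#|G|%:R : R) < ln ((#|A| ^ 2)%N%:R).
    rewrite ltr_ln ?posrE ?ltr0n ?expn_gt0 ?A0 ?(ltnW G1) //.
    by rewrite ltr_nat card_basis2.
  rewrite natrX lnXn ?ltr0n // mulr2n /defect; lra.
have -> : 1 - 2^-1 = 2^-1 :> R by lra.
(* One strict halving from the seed and [size s] from the remaining summands. *)
apply: (@lt_le_trans _ _ (2^-1 ^+ (size s).+1 * ln #|G|%:R)).
  by rewrite exprSr -mulrA ltr_pM2l ?exprn_gt0 ?invr_gt0.
rewrite exprVn mulrC ler_pdivrMr ?exprn_gt0 // mulrC -ler_pdivrMr ?ln2_gt0 //.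
have L0 := log2_gt0 G1.
rewrite -[_ / _]/(log2 _) -ler_ln ?posrE ?exprn_gt0 //.
by rewrite lnXn // -[ln _ *+ _]mulr_natl -ler_pdivrMr ?ln2_gt0.
Qed.

End Defect.
End Sumset.

Theorem theorem2 (R : realType) (G : finZmodType) (m K : nat)
    (A : 'I_(2 * K) -> {set G})
    (hG : (2 <= #|G|)%N) (hm : (0 < m)%N) (hK : (0 < K)%N)
    (hA : forall i : 'I_(2 * K), mfold_sumset m (A i) = [set: G]) :
  (m%:R * ln (log2 (#|G|%:R : R)) <= K%:R -> iter_sumset A = [set: G])
  /\
  (m = 2%N -> log2 (log2 (#|G|%:R : R)) <= K%:R -> iter_sumset A = [set: G]).
Proof.
pose s := [seq A i | i <- index_enum 'I_(2 * K)].
have sz_s : size s = (2 * K)%N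
  by rewrite size_map /index_enum -enumT size_enum_ord.
have hs : {in s, forall B, mfold_sumset m B = [set: G]}.
  by move=> B /mapP[i _ ->].
(* Both halves have length [K > 0], so each will exceed [|G| / 2]. *)
have eA : iter_sumset A = sumset (\big[@sumset G/[set 0]]_(B <- take K s) B)
                                 (\big[@sumset G/[set 0]]_(B <- drop K s) B).
  by rewrite -big_cat cat_take_drop big_map.
have hT : {in take K s, forall B, mfold_sumset m B = [set: G]}.
  by move=> B /mem_take; apply: hs.
have hD : {in drop K s, forall B, mfold_sumset m B = [set: G]}.
  by move=> B /mem_drop; apply: hs.
have szT : size (take K s) = K by rewrite size_takel // sz_s; lia.
have szD : size (drop K s) = K by rewrite size_drop sz_s; lia.
rewrite eA; split=> [leK|m2 leK].
  by apply: sumset_large; apply: (@half_of_ln _ R m); rewrite ?szT ?szD.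
rewrite {}m2 in hT hD.
by apply: sumset_large; apply: (@half_of_log2 _ R); rewrite ?szT ?szD.
Qed.
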